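(* Let $d\ge1$, $\eta>0$, and let $\mathcal{D}$ be the distribution on $\mathbb{R}^d\times\{-1,+1\}$ with $y$ uniform on $\{-1,+1\}$, $\bm{\mu}=(\eta,\dots,\eta)$, $\bm{x}\mid y=+1\sim\mathcal{N}(\bm{\mu},I)$ and $\bm{x}\mid y=-1\sim\mathcal{N}(-\bm{\mu},I)$. Let $0<\epsilon_{-1}<\epsilon_{+1}<\eta$. Consider linear classifiers $f(\bm{x})=\operatorname{sign}(\bm{w}^\top\bm{x}+b)$ with $\|\bm{w}\|_2=1$, $b\in\mathbb{R}$. Let $f_{nat}$ minimize the standard error $\Pr(f(\bm{x})\ne y)$, and let $f_{rob}$ minimize the class-dependent robust error $\Pr(\exists\bm{\delta},\ \|\bm{\delta}\|_\infty\le\epsilon_y:\ f(\bm{x}+\bm{\delta})\neq y)$ (adversarial training where perturbations of examples of class $y$ are bounded by $\epsilon_y$). With $\mathcal{R}_{nat}(f\mid y)=\Pr(f(\bm{x})\neq y\mid y)$, we have $$\mathcal{R}_{nat}(f_{nat}\mid -1)<\mathcal{R}_{nat}(f_{rob}\mid -1),\qquad \mathcal{R}_{nat}(f_{nat}\mid +1)>\mathcal{R}_{nat}(f_{rob}\mid +1).$$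
   Context: $I$ denotes the $d\times d$ identity matrix. *)

(* Defs.v *)
From HB Require Import structures.
From mathcomp Require Import all_boot all_order all_algebra.
From mathcomp Require Import all_classical all_reals all_analysis.
Set Implicit Arguments. Unset Strict Implicit. Unset Printing Implicit Defensive.
Import Order.TTheory GRing.Theory Num.Theory.
Import numFieldNormedType.Exports.
Local Open Scope classical_set_scope.
Local Open Scope ring_scope.

Section Defs.
Context {R : realType}.

(* Iterated integral of F against the standard Gaussian in coordinates
   0, ..., n-1 (i.e. integral w.r.t. the n-fold product of N(0,1)). *)
Fixpoint gauss_iter (n : nat) (F : (nat -> R) -> \bar R) : \bar R :=
  match n with
  | 0%N => F (fun _ => 0)
  | n'.+1 => gauss_iter n' (fun z =>
      (\int[@lebesgue_measure R]_t
         ((normal_pdf 0 1 t)%:E * F (fun k => if k == n' then t else z k)))%E)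
  end.

Definition std_gauss (d : nat) (A : set 'rV[R]_d) : \bar R :=
  gauss_iter d (fun z => (\1_A (\row_(i < d) z i))%:E).

Definition gauss (d : nat) (m : 'rV[R]_d) (A : set 'rV[R]_d) : \bar R :=
  std_gauss [set z | A (m + z)].

Definition dotv (d : nat) (u v : 'rV[R]_d) : R := \sum_(i < d) u 0 i * v 0 i.

Definition lin_clf (d : nat) (w : 'rV[R]_d) (b : R) (x : 'rV[R]_d) : R :=
  Num.sg (dotv w x + b).

Definition unit_l2 (d : nat) (w : 'rV[R]_d) : Prop := \sum_(i < d) w 0 i ^+ 2 = 1.

Definition muv (d : nat) (eta : R) : 'rV[R]_d := const_mx eta.

Definition nat_err_cond (d : nat) (eta : R) (w : 'rV[R]_d) (b y : R) : \bar R :=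
  gauss (y *: muv d eta) [set x | lin_clf w b x != y].

Definition rob_err_cond (d : nat) (eta : R) (w : 'rV[R]_d) (b y eps : R) : \bar R :=
  gauss (y *: muv d eta)
    [set x | exists delta : 'rV[R]_d,
       (forall i, `|delta 0 i| <= eps) /\ lin_clf w b (x + delta) != y].

Definition nat_err (d : nat) (eta : R) (w : 'rV[R]_d) (b : R) : \bar R :=
  ((1/2)%:E * nat_err_cond eta w b 1 + (1/2)%:E * nat_err_cond eta w b (-1))%E.

Definition rob_err (d : nat) (eta epsm epsp : R) (w : 'rV[R]_d) (b : R) : \bar R :=
  ((1/2)%:E * rob_err_cond eta w b 1 epsp
   + (1/2)%:E * rob_err_cond eta w b (-1) epsm)%E.

End Defs.

(* Main.v *)
(** For a unit vector [w], [w . z] is standard normal when [z] is.  So with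
    [Phi] the normal distribution function, [S] the sum of the [w_i] and [L] the
    sum of the [|w_i|], the robust error of class [y] with radius [eps] is
    [Phi (eps L - y b - eta S)], and [eps = 0] gives the natural error.  The
    arguments for the two classes add up to at least [- 2 a] with
    [a = (eta - (epsp + epsm) / 2) sqrt d], because [S <= L <= sqrt d], and
    [Phi x + Phi y] under the constraint [x + y >= - 2 a], where [a > 0], has
    [x = y = - a] as its only minimizer.  This forces [L = sqrt d] and moves the
    threshold from the natural value [0] to [(epsp - epsm) / 2 * sqrt d], in
    favour of class [+1]. *)

Require Import Defs.
From HB Require Import structures.
From mathcomp Require Import all_boot all_order all_algebra.
From mathcomp Require Import all_classical all_reals all_analysis.
From mathcomp Require Import measurable_realfun.
From mathcomp Require Import ring lra.
Import Order.TTheory GRing.Theory Num.Theory.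
Import numFieldNormedType.Exports.
Local Open Scope ring_scope.

(** * Affine change of variables for Lebesgue integrals *)

Section affine_substitution.
Context {R : realType}.
Local Open Scope classical_set_scope.
Local Notation mu := (@lebesgue_measure R).

Let aff (a b : R) : measurableTypeR R -> measurableTypeR R :=
  fun x => a * x + b.

Let measurable_aff a b : measurable_fun setT (aff a b).
Proof.
by apply: measurable_funD => //; apply: measurable_funM.
Qed.

Let preimage_aff a b (x y : R) : a != 0 ->
  mu (aff a b @^-1` `]x, y]) = (`|a|^-1%:E * mu `]x, y])%E.
Proof.
move=> a0; rewrite lebesgue_measure_itv /= lte_fin.
have [a_gt0|a_lt0|/eqP] := ltgtP 0 a; last by rewrite eq_sym (negbTE a0).
- have -> : aff a b @^-1` `]x, y] = `]((x - b) / a), ((y - b) / a)].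
    apply/seteqP; split => t /=; rewrite !in_itv /= /aff
      ltr_pdivrMr// ler_pdivlMr// (mulrC t) ltrBlDr lerBrDr//.
  rewrite lebesgue_measure_itv /= lte_fin ltr_pM2r ?invr_gt0// ltrD2r.
  case: ifPn => _; last by rewrite mule0.
  by rewrite -!EFinD -EFinM gtr0_norm//; congr EFin; field.
(* A negative slope moves the closed end to the left; the length is unaffected. *)
- have -> : aff a b @^-1` `]x, y] = `[((y - b) / a), ((x - b) / a)[.
    apply/seteqP; split => t /=; rewrite !in_itv /= /aff
      ltr_ndivlMr// ler_ndivrMr// (mulrC t) ltrBlDr lerBrDr//;
    by rewrite andbC.
  rewrite lebesgue_measure_itv /= lte_fin ltr_nM2r ?invr_lt0// ltrD2r.
  case: ifPn => _; last by rewrite mule0.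
  by rewrite -!EFinD -EFinM ltr0_norm//; congr EFin; field.
Qed.

(** The pushforward of Lebesgue measure along [x |-> a * x + b], scaled by [|a|], agrees with
    Lebesgue measure on half-open intervals, hence is equal to it by uniqueness. *)
Lemma ge0_integral_affine (a b : R) (f : R -> \bar R) : a != 0 ->
  measurable_fun setT f -> (forall x, 0 <= f x)%E ->
  (\int[mu]_x f x = `|a|%:E * \int[mu]_x f (a * x + b)%R)%E.
Proof.
move=> a0 mf f0.
have normE : `|a| = (NngNum (normr_ge0 a))%:num by [].
rewrite [in RHS]normE.
have -> : (\int[mu]_x f (a * x + b)%R =
    \int[mu]_(x in aff a b @^-1` setT) (f \o aff a b) x)%E by [].
rewrite -(ge0_integral_pushforward (measurable_aff a b))//=.
rewrite -ge0_integral_mscale//=.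
apply: eq_measure_integral => A mA _.
apply: lebesgue_measure_unique => //= _ [[x y]] _ <-.
rewrite /= /mscale /pushforward [X in (_ * X)%E](preimage_aff a b x y a0).
rewrite muleA -EFinM divff ?mul1e//.
by rewrite normr_eq0.
Qed.

End affine_substitution.

(** * The normal distribution function and the minimum of a sum of two of its values *)

Section gaussian_cdf.
Context {R : realType}.
Local Open Scope classical_set_scope.
Local Notation mu := (@lebesgue_measure R).
Local Notation phi := (@normal_pdf R 0 1).

Definition normal_cdf (x : R) : R := (\int[mu]_(t in `]-oo, x]) phi t)%R.

Lemma normal_pdf01E x : phi x = normal_peak 1 * expR (- (x ^+ 2 / 2)).
Proof.
by rewrite normal_pdfE ?oner_neq0// /normal_fun subr0 mulNr expr1n.
Qed.

Lemma normal_pdf01_gt0 x : 0 < phi x.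
Proof.
by rewrite normal_pdf01E mulr_gt0 ?expR_gt0// normal_peak_gt0// oner_neq0.
Qed.

Lemma is_derive_normal_cdf (x : R) : is_derive x 1 normal_cdf (phi x).
Proof.
(* The bound [x + 1] serves only to make [x] an interior point for the fundamental theorem of
   calculus. *)
have intphi : mu.-integrable [set` Interval -oo%O (BRight (x + 1))]
    (EFin \o phi).
  by apply: (integrableS measurableT) => //; exact: integrable_normal_pdf.
have cphi : {for x, continuous phi}.
  by apply: continuous_normal_pdf; exact: oner_neq0.
have xx1 : x < x + 1 by rewrite ltrDl.
have [||d1 d2] := @continuous_FTC1 R phi -oo%O x (x + 1)
  xx1 intphi.
- exact: ltNyr.
- exact: cphi.
by rewrite -d2 derive1E; apply/derivableP.
Qed.

Lemma continuous_normal_cdf : continuous normal_cdf.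
Proof.
move=> x; apply/differentiable_continuous/derivable1_diffP.
by have [] := is_derive_normal_cdf x.
Qed.

Lemma normal_cdf_lt (x y : R) : x < y -> normal_cdf x < normal_cdf y.
Proof.
move=> xy; rewrite -subr_gt0.
have [|c _ ->] := MVT xy (fun t _ => is_derive_normal_cdf t).
  exact/continuous_subspaceT/continuous_normal_cdf.
by rewrite mulr_gt0 ?normal_pdf01_gt0// subr_gt0.
Qed.

Lemma normal_cdf_le (x y : R) : x <= y -> normal_cdf x <= normal_cdf y.
Proof. by rewrite le_eqVlt => /predU1P[->//|/normal_cdf_lt/ltW]. Qed.

(* The derivative in [c] is [phi (c - a) - phi (c + a)], which is positive for
   [c > 0]. *)
Lemma normal_cdf_spread_gt0 (a c : R) : 0 < a -> 0 < c ->
  2 * normal_cdf (- a) < normal_cdf (- a - c) + normal_cdf (- a + c).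
Proof.
move=> a0 c0.
pose h (t : R) := normal_cdf (- a - t) + normal_cdf (- a + t).
have dh (t : R) : is_derive t 1 h (phi (- a + t) - phi (- a - t)).
  have d1 : is_derive t 1 (fun u : R => - a - u) (- 1).
    apply: (is_derive_eq (is_deriveB (is_derive_cst (- a) t 1)
      (is_derive_id t 1))).
    by rewrite sub0r.
  have d2 : is_derive t 1 (fun u : R => - a + u) 1.
    apply: (is_derive_eq (is_deriveD (is_derive_cst (- a) t 1)
      (is_derive_id t 1))).
    by rewrite add0r.
  have e1 := @is_derive1_comp R normal_cdf (fun u : R => - a - u) t _ _
    (is_derive_normal_cdf (- a - t)) d1.
  have e2 := @is_derive1_comp R normal_cdf (fun u : R => - a + u) t _ _
    (is_derive_normal_cdf (- a + t)) d2.
  apply: (is_derive_eq (is_deriveD e1 e2)).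
  by rewrite mulr1 mulrN1 addrC.
have ch : {within `[0, c], continuous h}.
  apply: continuous_subspaceT => t.
  apply/differentiable_continuous/derivable1_diffP.
  by have [] := dh t.
have [t + hE] := MVT c0 (fun t _ => dh t) ch.
rewrite in_itv /= => /andP[t0 _].
have : 0 < h c - h 0.
  rewrite hE subr0 mulr_gt0// subr_gt0 !normal_pdf01E ltr_pM2l; last first.
    by rewrite normal_peak_gt0// oner_neq0.
  by rewrite ltr_expR; nra.
by rewrite /h subr0 addr0 subr_gt0 mulr_natl mulr2n.
Qed.

Lemma normal_cdf_spread (a c : R) : 0 < a -> c != 0 ->
  2 * normal_cdf (- a) < normal_cdf (- a - c) + normal_cdf (- a + c).
Proof.
move=> a0; case: (ltgtP 0 c) => [c0 _|c0 _|//].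
  exact: normal_cdf_spread_gt0.
by rewrite addrC -{1}(opprK c); apply: normal_cdf_spread_gt0; rewrite ?oppr_gt0.
Qed.

(** The midpoint of [x] and [y] is at least [- a], so with half-gap [c] the pair dominates
    [- a - c], [- a + c]. The spread inequality then excludes [c != 0], and strict monotonicity
    excludes a common value above [- a]. *)
Lemma normal_cdf_add_min (a x y : R) : 0 < a -> - (2 * a) <= x + y ->
  normal_cdf x + normal_cdf y <= 2 * normal_cdf (- a) -> x = - a /\ y = - a.
Proof.
move=> a0 axy; set c := (y - x) / 2.
have xE : - a - c <= x by rewrite /c; lra.
have yE : - a + c <= y by rewrite /c; lra.
have [c0|c0] := eqVneq c 0; last first.
  rewrite leNgt (lt_le_trans (normal_cdf_spread a c a0 c0))//.
  by rewrite lerD ?normal_cdf_le.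
have yx : y = x.
  by apply/eqP; move/eqP: (c0); rewrite mulf_eq0 invr_eq0 pnatr_eq0 orbF
    subr_eq0.
have [xa|xa|xa] := ltgtP x (- a); last by rewrite yx xa.
  by move: xE; rewrite c0 subr0 leNgt xa.
by have := normal_cdf_lt _ _ xa; rewrite yx => xa_lt; lra.
Qed.

End gaussian_cdf.

(** * Gaussian measure of a half-space *)

Section gaussian_halfspace.
Context {R : realType}.
Local Open Scope classical_set_scope.
Local Notation mu := (@lebesgue_measure R).
Local Notation phi := (@normal_pdf R 0 1).

(** The distribution function of [N(0, sigma^2)] at [s]. Writing it through [sigma * t] allows
    [sigma = 0], the point mass at 0, so that indicators of half-lines are of the same form. *)
Definition gauss_lin_le (sigma s : R) : \bar R :=
  (\int[mu]_t ((phi t)%:E * ((sigma * t <= s)%R%:R)%:E))%E.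

Lemma gauss_lin_le0 s : gauss_lin_le 0 s = ((0 <= s)%R%:R)%:E.
Proof.
rewrite /gauss_lin_le.
under eq_integral do rewrite mul0r.
rewrite integralZr//; last exact: integrable_normal_pdf.
by rewrite integral_normal_pdf mul1e.
Qed.

Lemma gauss_lin_le1 s : gauss_lin_le 1 s = (normal_cdf s)%:E.
Proof.
rewrite /gauss_lin_le /normal_cdf /Rintegral fineK; last first.
  apply: integrable_fin_num => //.
  by apply: (integrableS measurableT) => //; exact: integrable_normal_pdf.
rewrite [RHS]integral_mkcond; apply: eq_integral => t _.
rewrite patchE mul1r mem_setE in_itv /=.
by case: ifP => _; rewrite ?mule1 ?mule0.
Qed.

Let measurable_le_ind d (T : measurableType d) (g : T -> R) (s : R) :
  measurable_fun setT g ->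
  measurable_fun setT (fun t => (((g t <= s)%R)%:R)%:E : \bar R).
Proof.
move=> mg.
have -> : (fun t => (((g t <= s)%R)%:R)%:E) =
    (EFin \o \1_(g @^-1` `]-oo, s])) :> (T -> \bar R).
  apply/funext => t /=; rewrite indicE; congr ((nat_of_bool _)%:R%:E).
  by apply/idP/idP => [h|/set_mem]; [apply/mem_set|]; rewrite /= in_itv.
apply/measurable_EFinP/measurable_indic.
by rewrite -[X in measurable X]setTI; exact: mg.
Qed.

Let measurable_pdf_le (sigma s : R) :
  measurable_fun setT (fun t => (phi t)%:E * ((sigma * t <= s)%R%:R)%:E)%E.
Proof.
apply: emeasurable_funM.
  by apply/measurable_EFinP; exact: measurable_normal_pdf.
by apply: measurable_le_ind; apply: measurable_funM.
Qed.

Lemma normal_pdf01N t : phi (- t) = phi t.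
Proof. by rewrite !normal_pdf01E sqrrN. Qed.

Lemma gauss_lin_leN sigma s : gauss_lin_le (- sigma) s = gauss_lin_le sigma s.
Proof.
rewrite /gauss_lin_le (ge0_integral_affine (-1) 0)//.
- rewrite normrN1 mul1e; apply: eq_integral => t _.
  by rewrite addr0 !mulN1r normal_pdf01N mulrNN.
- by move=> t; rewrite -EFinM lee_fin mulr_ge0// normal_pdf_ge0.
Qed.

(* Rotation invariance of the planar Gaussian, by the inner substitution
   [u = (rho v - w t) / sigma], for which
   [t^2 + u^2 = v^2 + ((rho t - w v) / sigma)^2], and Tonelli. *)
Lemma gauss_lin_le_rot (sigma w s : R) : sigma != 0 ->
  (\int[mu]_t ((phi t)%:E * gauss_lin_le sigma (s - w * t)))%E =
  gauss_lin_le (Num.sqrt (sigma ^+ 2 + w ^+ 2)) s.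
Proof.
move=> s0; set rho : R := Num.sqrt _; set a : R := rho / sigma.
set k := w / sigma.
have rho_sqr : rho ^+ 2 = sigma ^+ 2 + w ^+ 2.
  by rewrite sqr_sqrtr// addr_ge0 ?sqr_ge0.
have rho0 : rho != 0.
  by rewrite -sqrf_eq0 rho_sqr paddr_eq0 ?sqr_ge0// sqrf_eq0 (negbTE s0).
have a0 : a != 0 by rewrite mulf_neq0// invr_neq0.
have aE : a ^+ 2 = 1 + k ^+ 2 by rewrite /a expr_div_n rho_sqr /k; field.
have phi_rot t v : phi t * phi (a * v - k * t) = phi v * phi (a * t - k * v).
  rewrite !normal_pdf01E mulrACA [RHS]mulrACA -!expRD; congr (_ * expR _).
  rewrite -!opprD -!mulrDl; congr (- (_ / _)).
  by ring: aE.
pose G (p : R * R) : \bar R :=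
  (`|a| * (phi p.1 * phi (a * p.2 - k * p.1)) * (rho * p.2 <= s)%R%:R)%R%:E.
have G0 p : (0 <= G p)%E.
  by rewrite lee_fin !mulr_ge0// normal_pdf_ge0.
have mphi := @measurable_normal_pdf R 0 1.
have mG : measurable_fun setT G.
  have -> : G = (fun p => (`|a| * (phi p.1 * phi (a * p.2 - k * p.1)))%R%:E *
                 ((rho * p.2 <= s)%R%:R)%:E)%E.
    by apply/funext => p; rewrite -EFinM.
  apply: emeasurable_funM;
    last by apply: measurable_le_ind; apply: measurable_funM.
  apply/measurable_EFinP; apply: measurable_funM => //; apply: measurable_funM.
    exact: measurableT_comp.
  apply: measurableT_comp => //.
  by apply: measurable_funB; apply: measurable_funM.
(* [|a|] is the Jacobian of the substitution, after which the half-plane condition reads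
   [rho * v <= s] and no longer involves [t]. *)
transitivity (\int[mu]_t \int[mu]_v G (t, v))%E.
  apply: eq_integral => t _; rewrite /gauss_lin_le.
  rewrite (ge0_integral_affine a (- (k * t)))//; last first.
    by move=> u; rewrite -EFinM lee_fin mulr_ge0// normal_pdf_ge0.
  have mH : measurable_fun setT (fun v => (phi (a * v + - (k * t))%R)%:E *
      ((sigma * (a * v + - (k * t)) <= s - w * t)%R%:R)%:E)%E.
    apply: emeasurable_funM.
      apply/measurable_EFinP; apply: measurableT_comp => //.
      by apply: measurable_funB => //; apply: measurable_funM.
    apply: measurable_le_ind; apply: measurable_funM => //.
    by apply: measurable_funB => //; apply: measurable_funM.
  have H0 v : (0 <= (phi (a * v + - (k * t))%R)%:E *
      ((sigma * (a * v + - (k * t)) <= s - w * t)%R%:R)%:E)%E.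
    by rewrite -EFinM lee_fin mulr_ge0// normal_pdf_ge0.
  rewrite muleA -EFinM -ge0_integralZl//; last first.
    by rewrite lee_fin mulr_ge0// normal_pdf_ge0.
  apply: eq_integral => v _; rewrite -!EFinM /G /=; congr EFin.
  have -> : sigma * (a * v - k * t) = rho * v - w * t by rewrite /a /k; field.
  by rewrite lerD2r; ring.
rewrite (fubini_tonelli (m1 := mu) (m2 := mu) G)//.
apply: eq_integral => v _.
(* For fixed [v] what remains is [|a|] times the integral of [phi (a * t - k * v)] over [t], which
   is the total mass 1. *)
transitivity (\int[mu]_t (((phi v * (rho * v <= s)%R%:R)%R%:E * `|a|%:E) *
    (phi (a * t + - (k * v))%R)%:E))%E.
  apply: eq_integral => t _; rewrite /G /= phi_rot -!EFinM; congr EFin; ring.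
rewrite ge0_integralZl//; last 3 first.
- apply/measurable_EFinP; apply: measurableT_comp => //.
  by apply: measurable_funB => //; apply: measurable_funM.
- by move=> t _; rewrite lee_fin normal_pdf_ge0.
- by rewrite -EFinM lee_fin !mulr_ge0// normal_pdf_ge0.
rewrite -muleA -(ge0_integral_affine a (- (k * v)) (EFin \o phi))//.
- by rewrite integral_normal_pdf mule1 EFinM.
- exact/measurable_EFinP.
- by move=> t; rewrite lee_fin normal_pdf_ge0.
Qed.

(** Variances of independent centred normals add. The rotation divides by [sigma], so [sigma = 0] is
    separate: there the inner factor is an indicator, and evenness of [phi] turns [w] into [|w|]. *)
Lemma gauss_lin_le_conv (sigma w s : R) : 0 <= sigma ->
  (\int[mu]_t ((phi t)%:E * gauss_lin_le sigma (s - w * t)))%E =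
  gauss_lin_le (Num.sqrt (sigma ^+ 2 + w ^+ 2)) s.
Proof.
rewrite le_eqVlt => /predU1P[<-|s0]; last first.
  by apply: gauss_lin_le_rot; rewrite gt_eqF.
rewrite expr0n add0r sqrtr_sqr.
transitivity (gauss_lin_le w s).
  by apply: eq_integral => t _; rewrite gauss_lin_le0 subr_ge0.
by have [//|_] := ger0P w; rewrite gauss_lin_leN.
Qed.

(** The innermost integral of [gauss_iter] is over the last coordinate and adds [v n ^+ 2] to the
    variance; hence the induction over all [sigma]. *)
Lemma gauss_iter_lin_le (n : nat) (v : nat -> R) (sigma s : R) : 0 <= sigma ->
  gauss_iter n (fun z => gauss_lin_le sigma (s - \sum_(i < n) v i * z i)) =
  gauss_lin_le (Num.sqrt (sigma ^+ 2 + \sum_(i < n) v i ^+ 2)) s.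
Proof.
elim: n sigma s => [|n IH] sigma s sigma0 /=.
  by rewrite !big_ord0 subr0 addr0 sqrtr_sqr ger0_norm.
transitivity (gauss_iter n (fun z => gauss_lin_le
    (Num.sqrt (sigma ^+ 2 + v n ^+ 2)) (s - \sum_(i < n) v i * z i))).
  congr gauss_iter; apply/funext => z.
  rewrite -gauss_lin_le_conv//; apply: eq_integral => t _.
  congr (_ * gauss_lin_le _ _)%E.
  rewrite big_ord_recr /= eqxx opprD addrA; congr (_ - _ - _).
  by apply: eq_bigr => i _; rewrite ltn_eqF.
rewrite IH ?sqrtr_ge0// sqr_sqrtr ?addr_ge0 ?sqr_ge0//.
by rewrite big_ord_recr /= -addrA (addrC (v n ^+ 2)).
Qed.

Lemma std_gauss_halfspace (d : nat) (w : 'rV[R]_d) (s : R) : unit_l2 w ->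
  std_gauss [set z | dotv w z <= s] = (normal_cdf s)%:E.
Proof.
(* [gauss_iter] works on sequences indexed by [nat], so [w] is extended by 0. *)
move=> w1; pose v k := if insub k is Some i then w 0 i else 0.
have vE (i : 'I_d) : v i = w 0 i by rewrite /v valK.
transitivity (gauss_iter d (fun z =>
    gauss_lin_le 0 (s - \sum_(i < d) v i * z i))).
  rewrite /std_gauss; congr gauss_iter; apply/funext => z.
  rewrite gauss_lin_le0 indicE; congr ((nat_of_bool _)%:R%:E).
  have -> : \sum_(i < d) v i * z i = dotv w (\row_(i < d) z i).
    by apply: eq_bigr => i _; rewrite mxE vE.
  by rewrite subr_ge0; apply/idP/idP => [/set_mem//|h]; apply/mem_set.
rewrite gauss_iter_lin_le// expr0n add0r.
under eq_bigr do rewrite vE.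
by rewrite w1 sqrtr1 gauss_lin_le1.
Qed.

End gaussian_halfspace.

(** * Closed forms for the errors of linear classifiers *)

Section linear_classifiers.
Context {R : realType} {d : nat}.
Local Open Scope classical_set_scope.
Implicit Types (w x z : 'rV[R]_d) (b y eta eps : R).

Definition sumv w : R := \sum_(i < d) w 0 i.

Definition norm1 w : R := \sum_(i < d) `|w 0 i|.

Lemma dotvD w x z : dotv w (x + z) = dotv w x + dotv w z.
Proof. by rewrite -big_split; apply: eq_bigr => i _; rewrite mxE mulrDr. Qed.

(** On the decision boundary the sign is 0, which differs from both labels; hence the large
    inequality. *)
Lemma lin_clf_neq w b x y : y ^+ 2 = 1 ->
  (lin_clf w b x != y) = (y * (dotv w x + b) <= 0).
Proof.
rewrite /lin_clf => /eqP; rewrite sqrf_eq1 => /orP[]/eqP->; rewrite sgr_cp0.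
  by rewrite mul1r leNgt.
by rewrite mulN1r oppr_le0 leNgt.
Qed.

(** The vector [y *: w] is again a unit vector, and by [y ^+ 2 = 1] the mean contributes
    [eta * sumv w] for either label. *)
Lemma gauss_muv_halfspace w b y eta c : unit_l2 w -> y ^+ 2 = 1 ->
  gauss (y *: muv d eta) [set x | y * (dotv w x + b) <= c] =
  (normal_cdf (c - y * b - eta * sumv w))%:E.
Proof.
move=> w1 y1; have yw1 : unit_l2 (y *: w).
  rewrite /unit_l2 -[RHS]w1; apply: eq_bigr => i _.
  by rewrite mxE exprMn y1 mul1r.
rewrite -(std_gauss_halfspace d (y *: w))//; congr std_gauss.
apply/funext => z /=; congr (is_true _).
have -> : dotv (y *: w) z = y * dotv w z.
  by rewrite mulr_sumr; apply: eq_bigr => i _; rewrite mxE mulrA.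
have muE : y * dotv w (y *: muv d eta) = eta * sumv w.
  rewrite /sumv !mulr_sumr; apply: eq_bigr => i _; rewrite !mxE.
  by ring: y1.
by rewrite dotvD 2!mulrDr muE; apply/idP/idP => ?; lra.
Qed.

Lemma nat_err_condE w b y eta : unit_l2 w -> y ^+ 2 = 1 ->
  nat_err_cond eta w b y = (normal_cdf (- (y * b) - eta * sumv w))%:E.
Proof.
move=> w1 y1; rewrite -[- (y * b)]sub0r -gauss_muv_halfspace//.
by congr gauss; apply/funext => x /=; rewrite lin_clf_neq.
Qed.

(* The worst perturbation moves every coordinate by [eps] against [y * w]. *)
Lemma linf_attackP w b x y eps : y ^+ 2 = 1 -> 0 <= eps ->
  (exists delta : 'rV[R]_d,
     (forall i, `|delta 0 i| <= eps) /\ lin_clf w b (x + delta) != y) <->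
  y * (dotv w x + b) <= eps * norm1 w.
Proof.
move=> y1 eps0.
have ny : `|y| = 1.
  by move/eqP: y1; rewrite sqrf_eq1 => /orP[]/eqP->; rewrite ?normrN normr1.
split=> [[delta [le_eps]]|le_L].
  rewrite lin_clf_neq// dotvD => le0.
  suff : - (y * dotv w delta) <= eps * norm1 w by lra.
  rewrite /norm1 !mulr_sumr -sumrN; apply: ler_sum => i _.
  rewrite (le_trans (ler_norm _))// normrN !normrM ny mul1r mulrC.
  by rewrite ler_wpM2r.
exists (\row_i (- eps * y * Num.sg (w 0 i))); split=> [i|].
  rewrite mxE !normrM normrN ny mulr1 normr_sg (ger0_norm eps0).
  by case: eqP => _; rewrite ?mulr0 ?mulr1.
rewrite lin_clf_neq// dotvD.
suff -> : dotv w (\row_i (- eps * y * Num.sg (w 0 i))) =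
    - y * (eps * norm1 w).
  move: y1; set L := eps * _ in le_L *; set D := dotv w x in le_L * => y1.
  suff -> : y * (D + - y * L + b) = y * (D + b) - L by lra.
  by ring: y1.
rewrite /norm1 !mulr_sumr; apply: eq_bigr => i _.
by rewrite mxE normrEsg; ring.
Qed.

Lemma rob_err_condE w b y eta eps : unit_l2 w -> y ^+ 2 = 1 -> 0 <= eps ->
  rob_err_cond eta w b y eps =
  (normal_cdf (eps * norm1 w - y * b - eta * sumv w))%:E.
Proof.
move=> w1 y1 eps0; rewrite -gauss_muv_halfspace//.
congr gauss; apply/funext => x /=; apply/propext; exact: linf_attackP.
Qed.

(** Cauchy-Schwarz against the all-ones vector, read off from the expansion of a sum of squares. *)
Lemma norm1_unit_l2_le w : (1 <= d)%N -> unit_l2 w ->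
  norm1 w <= Num.sqrt d%:R.
Proof.
move=> d1 w1; rewrite /norm1; set L := \sum_(i < d) _; set r : R := Num.sqrt _.
have r_sqr : r ^+ 2 = d%:R by rewrite sqr_sqrtr.
have r0 : 0 < r by rewrite sqrtr_gt0 ltr0n.
have : 0 <= \sum_(i < d) (r * `|w 0 i| - 1) ^+ 2.
  by apply: sumr_ge0 => i _; exact: sqr_ge0.
have -> : \sum_(i < d) (r * `|w 0 i| - 1) ^+ 2 =
    r ^+ 2 * (\sum_(i < d) w 0 i ^+ 2) - 2 * r * L + d%:R.
  have -> : d%:R = \sum_(i < d) (1 : R) by rewrite sumr_const card_ord.
  rewrite !mulr_sumr -sumrB -big_split /=.
  by apply: eq_bigr => i _; rewrite -[w 0 i ^+ 2]real_normK ?num_real//; ring.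
rewrite w1 -r_sqr => h.
by rewrite -(ler_pM2l r0); nra.
Qed.

Lemma sumv_le_norm1 w : sumv w <= norm1 w.
Proof. by apply: ler_sum => i _; exact: ler_norm. Qed.

(** The direction of the mean, where [sumv <= norm1 <= sqrt d] is an equality throughout; it is the
    competitor for both minimizers. *)
Definition diag_unit : 'rV[R]_d := const_mx (Num.sqrt d%:R)^-1.

Lemma unit_l2_diag_unit : (1 <= d)%N -> unit_l2 diag_unit.
Proof.
move=> d1; rewrite /unit_l2; under eq_bigr do rewrite mxE.
rewrite sumr_const card_ord exprVn sqr_sqrtr// -[LHS]mulr_natl divff//.
by rewrite pnatr_eq0 -lt0n.
Qed.

Lemma sumv_diag_unit : (1 <= d)%N -> sumv diag_unit = Num.sqrt d%:R.
Proof.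
move=> d1; rewrite /sumv; under eq_bigr do rewrite mxE.
rewrite sumr_const card_ord -[LHS]mulr_natl -{1}[d%:R]sqr_sqrtr// expr2 mulfK//.
by rewrite gt_eqF// sqrtr_gt0 ltr0n.
Qed.

Lemma norm1_diag_unit : (1 <= d)%N -> norm1 diag_unit = Num.sqrt d%:R.
Proof.
move=> d1; rewrite -sumv_diag_unit//; apply: eq_bigr => i _.
by rewrite mxE ger0_norm// invr_ge0.
Qed.

End linear_classifiers.

(** * Comparison of the natural and the robust minimizer *)

Theorem theorem3 (R : realType) (d : nat) (eta epsm epsp : R)
  (wn : 'rV[R]_d) (bn : R) (wr : 'rV[R]_d) (br : R) :
  (1 <= d)%N -> 0 < eta -> 0 < epsm -> epsm < epsp -> epsp < eta ->
  unit_l2 wn ->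
  (forall (w : 'rV[R]_d) (b : R), unit_l2 w ->
     (nat_err eta wn bn <= nat_err eta w b)%E) ->
  unit_l2 wr ->
  (forall (w : 'rV[R]_d) (b : R), unit_l2 w ->
     (rob_err eta epsm epsp wr br <= rob_err eta epsm epsp w b)%E) ->
  (nat_err_cond eta wn bn (-1) < nat_err_cond eta wr br (-1))%E /\
  (nat_err_cond eta wn bn 1 > nat_err_cond eta wr br 1)%E.
Proof.
move=> d1 eta0 epsm0 epsmp epspeta wn1 wn_min wr1 wr_min.
have one2 : 1 ^+ 2 = 1 :> R by rewrite expr1n.
have mone2 : (- 1) ^+ 2 = 1 :> R by rewrite sqrrN expr1n.
have epsp_ge0 : 0 <= epsp by lra.
have epsm_ge0 := ltW epsm0.
set r : R := Num.sqrt d%:R.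
have r0 : 0 < r by rewrite sqrtr_gt0 ltr0n.
have u1 := @unit_l2_diag_unit R d d1.
have uS := @sumv_diag_unit R d d1.
have uL := @norm1_diag_unit R d d1.
have := wn_min diag_unit 0 u1.
rewrite /nat_err !nat_err_condE// uS -!EFinM -!EFinD lee_fin.
(* This bias makes the two robust arguments of the competitor equal, both being [- a]. *)
have := wr_min diag_unit ((epsp - epsm) / 2 * r) u1.
rewrite /rob_err !rob_err_condE// uS uL -/r -!EFinM -!EFinD lee_fin.
have Ln := norm1_unit_l2_le wn d1 wn1.
have Lr := norm1_unit_l2_le wr d1 wr1.
have Sn := sumv_le_norm1 wn.
have Sr := sumv_le_norm1 wr.
rewrite -/r in Ln Lr; move: Ln Lr Sn Sr.
set S := sumv wn; set L := norm1 wn.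
set S' := sumv wr; set L' := norm1 wr.
move=> Lr L'r SL S'L'.
rewrite !mul1r !mulN1r !opprK.
set a := (eta - (epsp + epsm) / 2) * r.
have a0 : 0 < a by rewrite /a mulr_gt0//; lra.
have -> : epsp * r - (epsp - epsm) / 2 * r - eta * r = - a by rewrite /a; field.
have -> : epsm * r + (epsp - epsm) / 2 * r - eta * r = - a by rewrite /a; field.
rewrite oppr0 sub0r => rob_min nat_min.
have [nE1 nE2] : - bn - eta * S = - (eta * r) /\ bn - eta * S = - (eta * r).
  by apply: normal_cdf_add_min; [nra|nra|lra].
have [rE1 rE2] : epsp * L' - br - eta * S' = - a /\
    epsm * L' + br - eta * S' = - a.
  apply: normal_cdf_add_min => //; last lra.
  by rewrite /a; nra.
(* The two equations sum to [(epsp + epsm) * L' - 2 * eta * S' = - 2 * a]; since [S' <= L'] and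
   [epsp + epsm < 2 * eta], a value [L' < r] would make the left side too large. *)
have L'E : L' = r.
  apply/eqP; rewrite eq_le L'r /= leNgt; apply/negP => L'_lt.
  by move: rE1 rE2; rewrite /a => ? ?; nra.
rewrite !lte_fin nE1 nE2.
(* The natural arguments of the robust classifier are [- a - epsm * r] for class -1 and
   [- a - epsp * r] for class +1. They lie on either side of [- (eta * r)], which is
   [- a - (epsp + epsm) / 2 * r]. *)
by split; apply: normal_cdf_lt; move: rE1 rE2; rewrite L'E /a => ? ?; nra.
Qed.
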